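(* Let $I$ and $I'$ be PESP instances with fractional periodic timetabling polytopes $\mathcal P$ and $\mathcal P'$, respectively. Suppose that $I'$ arises from $I$ by a sequence of simple free augmentations. If $\varphi:\mathcal P'\to\mathcal P$ denotes the natural projection, then $\varphi(\mathcal P'_{\mathrm{split}})=\mathcal P_{\mathrm{split}}$.
   Context: A PESP instance $(G,T,\ell,u,w)$ consists of a finite weakly connected directed graph $G=(V,A)$, a period $T\in\mathbb N$, $T\ge 2$, bounds $\ell,u\in\mathbb Z^A$ and weights $w\in\mathbb R^A$. The cycle space is $\mathcal C=\{\gamma\in\mathbb Z^A \mid \sum_{a\in\delta^+(i)}\gamma_a=\sum_{a\in\delta^-(i)}\gamma_a\ \forall i\in V\}$, of rank $\mu=|A|-|V|+1$. An oriented cycle is an element of $\mathcal C\cap\{-1,0,1\}^A$. An integral cycle basis is a set $B$ of $\mu$ oriented cycles forming a $\mathbb Z$-basis of $\mathcal C$; its cycle matrix $\Gamma\in\{-1,0,1\}^{B\times A}$ has the elements of $B$ as rows. The fractional periodic timetabling polytope is $\mathcal P=\{(x,z)\in\mathbb R^A\times\mathbb R^B\mid \Gamma x=Tz,\ \ell\le x\le u\}$. Its split closure (with $z$ the integer variables) is $\mathcal P_{\mathrm{split}}=\bigcap_{\beta\in\mathbb Z^B}\operatorname{conv}\{(x,z)\in\mathcal P\mid\beta^\top z\in\mathbb Z\}$. Simple free augmentation: $I'=(G',T,\ell',u',w')$ is a simple free augmentation of $I=(G,T,\ell,u,w)$ by $\overline a$ if $I$ arises from $I'$ by deleting an arc $\overline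 a$ (together with an end vertex that becomes isolated, if any) which is free, i.e., $u'_{\overline a}-\ell'_{\overline a}=T-1$. Natural projection: for one simple free augmentation by $\overline a$, if $\overline a$ is a bridge of $G'$, the same integral cycle basis $B$ is used for $G$ and $G'$ and the projection is $(x,x_{\overline a},z)\mapsto(x,z)$. If $\overline a$ is not a bridge, one uses an integral cycle basis $B$ of $G$ and an integral cycle basis $B'=B\cup\{\overline\gamma\}$ of $G'$, where $\overline\gamma$ is an oriented cycle containing $\overline a$ (elements of the cycle space of $G$ being extended by $0$ on $\overline a$), and the projection is $(x,x_{\overline a},z,z_{\overline\gamma})\mapsto(x,z)$. For a sequence of simple free augmentations, the cycle bases are extended in this way step by step and the natural projection is the composition of these projections. *)

(* Defs.v *)
From HB Require Import structures.
From mathcomp Require Import all_boot all_order all_algebra.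
From mathcomp Require Import mathcomp_extra boolp classical_sets reals convex.

Set Implicit Arguments.
Unset Strict Implicit.
Unset Printing Implicit Defensive.

Import Order.TTheory GRing.Theory Num.Theory.

Local Open Scope classical_set_scope.
Local Open Scope ring_scope.

(** ** Directed graphs *)

(** Parallel arcs and loops are allowed. *)
Record digraph := Digraph {
  verts : finType;
  arcs : finType;
  src : arcs -> verts;
  tgt : arcs -> verts }.

Section Graphs.
Variable G : digraph.

Definition uadj (D : {set arcs G}) : rel (verts G) := fun v w =>
  [exists a in D, ((src a == v) && (tgt a == w))
               || ((src a == w) && (tgt a == v))].

(** The spanning subgraph with arc set [D] is weakly connected. *)
Definition weakly_connected_on (D : {set arcs G}) : Prop :=
  forall v w : verts G, connect (uadj D) v w.

Definition weakly_connected : Prop :=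
  (0 < #|verts G|)%N /\ weakly_connected_on [set: arcs G].

(** Only used in weakly connected graphs, where an arc is a bridge iff its
    removal (keeping all vertices) disconnects the graph. *)
Definition bridge (a : arcs G) : Prop := ~ weakly_connected_on [set~ a].

Definition cycle_space : set {ffun arcs G -> int} :=
  [set g : {ffun arcs G -> int} | forall i : verts G,
     \sum_(a | src a == i) g a = \sum_(a | tgt a == i) g a].

Definition oriented_cycle : set {ffun arcs G -> int} :=
  [set g : {ffun arcs G -> int} | cycle_space g /\ forall a, g a \in [:: -1; 0; 1]].

End Graphs.

(** ** PESP instances *)

Record pesp (R : realType) := Pesp {
  graph :> digraph;
  period : nat;
  lower : arcs graph -> int;
  upper : arcs graph -> int;
  weight : arcs graph -> R;
  pesp_connected : weakly_connected graph;
  period_ge2 : (2 <= period)%N }.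

(** The basis elements are listed without repetition by a finite index type
    (distinctness is forced by [cb_basis]); [cb_cycle] is the cycle matrix. *)
Record cycle_basis (G : digraph) := CycleBasis {
  cb_index :> finType;
  cb_cycle : cb_index -> {ffun arcs G -> int};
  cb_oriented : forall b, oriented_cycle (cb_cycle b);
  cb_card : (#|cb_index| + #|verts G| = #|arcs G| + 1)%N;
  cb_basis : forall g, cycle_space g ->
    exists! c : {ffun cb_index -> int},
      forall a, g a = \sum_b c b * cb_cycle b a }.

(** ** Polytope and split closure *)

Definition conv_hull (R : numDomainType) (E : lmodType R) (S : set E) : set E :=
  smallest (@convex_set R E) S.

Definition xz_space (R : realType) (I : pesp R) (B : cycle_basis I) : lmodType R :=
  ({ffun arcs I -> R^o} * {ffun B -> R^o})%type.

Section Polytope.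
Variables (R : realType) (I : pesp R) (B : cycle_basis I).

Definition polytope : set (xz_space B) :=
  [set p : xz_space B |
    (forall b : B, \sum_a (cb_cycle b a)%:~R * p.1 a = (period I)%:R * p.2 b) /\
    (forall a : arcs I, (lower a)%:~R <= p.1 a <= (upper a)%:~R)].

Definition split_slice (beta : {ffun B -> int}) : set (xz_space B) :=
  [set p : xz_space B | polytope p /\ \sum_b (beta b)%:~R * p.2 b \is a Num.int].

Definition split_closure : set (xz_space B) :=
  \bigcap_(beta in [set: {ffun B -> int}])
    conv_hull (split_slice beta).

End Polytope.

Arguments polytope {R I} B _.
Arguments split_slice {R I} B beta _.
Arguments split_closure {R I} B _.

(** ** Simple free augmentations *)

(** [I'] is a simple free augmentation of [I] by [sfa_new], where [I] is
    identified with a subinstance of [I'] along [sfa_vert] and [sfa_arc].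
    By [sfa_vert_deleted], the vertices of [I'] missing from [I] are ends of
    the new arc that become isolated when it is deleted; as both graphs are
    weakly connected and nonempty, there is at most one such vertex, and an end
    vertex that becomes isolated can only be kept if it is the whole vertex set
    of [I]. *)
Record simple_free_augmentation (R : realType) (I I' : pesp R) := SFA {
  sfa_new : arcs I';
  sfa_vert : verts I -> verts I';
  sfa_arc : arcs I -> arcs I';
  sfa_vert_inj : injective sfa_vert;
  sfa_arc_inj : injective sfa_arc;
  sfa_arc_image : forall a', (a' \in codom sfa_arc) = (a' != sfa_new);
  sfa_vert_deleted : forall v', v' \notin codom sfa_vert ->
    (v' = src sfa_new \/ v' = tgt sfa_new) /\
    forall a', a' != sfa_new -> v' <> src a' /\ v' <> tgt a';
  sfa_src : forall a, src (sfa_arc a) = sfa_vert (src a);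
  sfa_tgt : forall a, tgt (sfa_arc a) = sfa_vert (tgt a);
  sfa_period : period I' = period I;
  sfa_lower : forall a, lower (sfa_arc a) = lower a;
  sfa_upper : forall a, upper (sfa_arc a) = upper a;
  sfa_weight : forall a, weight (sfa_arc a) = weight a;
  sfa_free : upper sfa_new - lower sfa_new = (period I')%:Z - 1 }.

(** Elements of [B], extended by 0 on the new arc, are among those of [B'];
    they exhaust [B'] if the new arc is a bridge, and otherwise [B'] has exactly
    one further element, which uses the new arc. *)
Record basis_extension (R : realType) (I I' : pesp R)
    (s : simple_free_augmentation I I')
    (B : cycle_basis I) (B' : cycle_basis I') := BasisExtension {
  be_index : B -> B';
  be_inj : injective be_index;
  be_old : forall b a, cb_cycle (be_index b) (sfa_arc s a) = cb_cycle b a;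
  be_new : forall b, cb_cycle (be_index b) (sfa_new s) = 0;
  be_bridge : bridge (sfa_new s) -> forall b', b' \in codom be_index;
  be_not_bridge : ~ bridge (sfa_new s) ->
    exists g : B', cb_cycle g (sfa_new s) != 0 /\
      forall b', (b' \in codom be_index) = (b' != g) }.

Definition simple_projection (R : realType) (I I' : pesp R)
    (s : simple_free_augmentation I I')
    (B : cycle_basis I) (B' : cycle_basis I') (e : basis_extension s B B')
    (p : xz_space B') : xz_space B :=
  ([ffun a => p.1 (sfa_arc s a)], [ffun b => p.2 (be_index e b)]).

(** Sequences of simple free augmentations starting at [I], with the cycle
    bases extended step by step from the basis [B] of [I]. *)
Inductive free_augmentation (R : realType) (I : pesp R) (B : cycle_basis I) :
    forall I' : pesp R, cycle_basis I' -> Type :=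
| fa_nil : free_augmentation B B
| fa_snoc (I' I'' : pesp R) (B' : cycle_basis I') (B'' : cycle_basis I'')
    (s : simple_free_augmentation I' I'') (e : basis_extension s B' B'') :
    free_augmentation B B' -> free_augmentation B B''.

Fixpoint natural_projection (R : realType) (I : pesp R) (B : cycle_basis I)
    (I' : pesp R) (B' : cycle_basis I') (f : free_augmentation B B') :
    xz_space B' -> xz_space B :=
  match f with
  | fa_nil => id
  | fa_snoc _ _ _ _ _ e f0 => natural_projection f0 \o simple_projection e
  end.

(* Main.v *)
(** Since [z] is determined by [x], the split of the polytope along [beta] is
    governed by the box [l <= x <= u] and the cycle vector [g] combined from the
    basis with coefficients [beta]: a point is in the convex hull of the slice iff
    [x] is a convex combination of points of the box with [g . x] in [T Z]. This
    fails only if a flip inequality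
      [fall / (g.v - c T) + rise / ((c + 1) T - g.v) >= 1]
    is violated, where [v] is a vertex of the box with [c T < g.v < (c + 1) T].

    To lift a point [x] of the split closure along a free arc, a value [t] for the
    arc is needed that satisfies the flip inequalities of all cycles [(g, k)] with
    coefficient [k] on the arc. If [k = 0] any [t] works. If [k > 0] each of them
    bounds [t] from below or from above, so it suffices to compare pairs. A lower
    bound from [(g1, k1)] and an upper bound from [(g2, k2)] are compatible because
    the resulting affine inequality in [x] holds where [(k2 g1 - k1 g2) . x] is in
    [T Z], hence also for [x], which is in the convex hull of these points:
    [k2 g1 - k1 g2] is a cycle vector of the smaller instance. This step uses that
    the bounds are integers and that the arc has span exactly [T - 1]. *)

Require Import Defs.
From mathcomp Require Import all_boot all_order all_algebra.
From mathcomp Require Import interval_inference boolp classical_sets reals convex.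
From mathcomp Require Import ring lra zify.

Set Implicit Arguments.
Unset Strict Implicit.
Unset Printing Implicit Defensive.

Import Order.TTheory GRing.Theory Num.Theory.

Local Open Scope classical_set_scope.
Local Open Scope ring_scope.

(** * Flip inequalities *)

Section Flips.
Variables (R : realType) (A : finType).
Implicit Types (l u g : A -> int) (x y : A -> R) (F : {set A}) (T c : int).

Definition in_box l u x := forall a, (l a)%:~R <= x a <= (u a)%:~R.

Definition dot g x : R := \sum_a (g a)%:~R * x a.

(* The vertex of the box at which the flip inequality of [g] and [F] is based:
   on [F] the functional [g] is maximal, off [F] it is minimal. *)
Definition corner l u g F a : int :=
  if (a \in F) == (0 < g a) then u a else l a.

Definition corner_val l u g F : int := \sum_a g a * corner l u g F a.

Definition rise l u g F x : R :=
  \sum_(a | a \notin F) (g a)%:~R * (x a - (corner l u g F a)%:~R).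

Definition fall l u g F x : R :=
  \sum_(a in F) (g a)%:~R * ((corner l u g F a)%:~R - x a).

Definition flip_violated T l u g F c x :=
  [/\ c * T < corner_val l u g F, corner_val l u g F < (c + 1) * T &
    fall l u g F x / (corner_val l u g F - c * T)%:~R +
    rise l u g F x / ((c + 1) * T - corner_val l u g F)%:~R < 1].

Lemma rise_ge0 l u g F x : in_box l u x -> 0 <= rise l u g F x.
Proof.
move=> xb; apply: sumr_ge0 => a /negbTE aF; rewrite /corner aF.
have /andP[xl xu] := xb a; case: ltP => g0 /=.
  by apply: mulr_ge0; [rewrite ler0z ltW|rewrite subr_ge0].
by apply: mulr_le0; [rewrite lerz0|rewrite subr_le0].
Qed.

Lemma fall_ge0 l u g F x : in_box l u x -> 0 <= fall l u g F x.
Proof.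
move=> xb; apply: sumr_ge0 => a aF; rewrite /corner aF.
have /andP[xl xu] := xb a; case: ltP => g0 /=.
  by apply: mulr_ge0; [rewrite ler0z ltW|rewrite subr_ge0].
by apply: mulr_le0; [rewrite lerz0|rewrite subr_le0].
Qed.

Lemma rise_fall l u g F x :
  rise l u g F x - fall l u g F x = dot g x - (corner_val l u g F)%:~R.
Proof.
rewrite /dot /corner_val rmorph_sum /= -sumrB /rise /fall -sumrN.
rewrite [in RHS](bigID (mem F)) /= addrC; congr (_ + _); apply: eq_bigr => a _.
  by rewrite rmorphM /=; ring.
by rewrite rmorphM /=; ring.
Qed.

Lemma dot_comb g x y (r s : R) :
  dot g (fun a => r * x a + s * y a) = r * dot g x + s * dot g y.
Proof. by rewrite /dot !mulr_sumr -big_split /=; apply: eq_bigr => a _; ring. Qed.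

Lemma in_box_comb l u x y (r : R) : 0 <= r <= 1 ->
  in_box l u x -> in_box l u y -> in_box l u (fun a => r * x a + (1 - r) * y a).
Proof.
move=> /andP[r0 r1] xb yb a.
have /andP[xl xu] := xb a; have /andP[yl yu] := yb a.
apply/andP; split; nra.
Qed.

(* Among the pairs of points of the box dividing [x] in the ratio prescribed by
   [dot g x], take the one minimizing [dot g x0]. Either it can be moved towards
   [x] until [dot g x0 = c * T], or the vertex of the box to which all coordinates
   of [x0] or [x1] are pushed violates its flip inequality. *)
Lemma box_split T l u g x c : 0 < T -> in_box l u x ->
  (c * T)%:~R < dot g x < ((c + 1) * T)%:~R ->
  (forall F, ~ flip_violated T l u g F c x) ->
  exists r x0 x1, [/\ 0 <= r <= 1, in_box l u x0 /\ in_box l u x1,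
    x = (fun a => r * x0 a + (1 - r) * x1 a),
    dot g x0 = (c * T)%:~R & dot g x1 = ((c + 1) * T)%:~R].
Proof.
move=> T0 xb /andP[xlo xhi] noviol.
have T0' : 0 < (T%:~R : R) by rewrite ltr0z.
move: xlo xhi; rewrite !rmorphM rmorphD /= => xlo xhi.
set tau := (T%:~R : R) in T0' xlo xhi *; set k := (c%:~R : R) in xlo xhi *.
(* [m] is the position of [dot g x] between the levels [k * tau] and [(k + 1) * tau], hence the
   weight that [x1] must get. *)
pose m : R := dot g x / tau - k; pose r : R := 1 - m.
have sE : dot g x = (k + m) * tau by rewrite /m; field; rewrite gt_eqF.
have m0 : 0 < m by rewrite subr_gt0 ltr_pdivlMr.
have r0 : 0 < r by rewrite subr_gt0 ltrBlDr ltr_pdivrMr // addrC.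
have mE : m = 1 - r by rewrite /r; ring.
clearbody m; clear mE.
(* On [F], [x1] can take the [g]-maximal bound with [x0] staying in the box; off [F], [x0] can take
   the [g]-minimal bound instead. *)
pose F : {set A} := [set a | if 0 < g a then r * (l a)%:~R + m * (u a)%:~R <= x a
                       else x a <= r * (u a)%:~R + m * (l a)%:~R]%SET.
pose v a : R := (corner l u g F a)%:~R.
pose x0 a := if a \in F then v a + (x a - v a) / r else v a.
pose x1 a := if a \in F then v a else v a + (x a - v a) / m.
have xE a : x a = r * x0 a + m * x1 a.
  by rewrite /x0 /x1 /r; case: ifP => _; field; rewrite gt_eqF.
have rm : r + m = 1 by rewrite /r subrK.
have [x0b x1b] : in_box l u x0 /\ in_box l u x1.
  suff H a : ((l a)%:~R <= x0 a <= (u a)%:~R) && ((l a)%:~R <= x1 a <= (u a)%:~R).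
    by split=> a; case/andP: (H a).
  have /andP[xl xu] := xb a; have lu := le_trans xl xu; have xEa := xE a.
  have rmZ (y : R) : r * y + m * y = y by rewrite -mulrDl rm mul1r.
  have rL := rmZ (l a)%:~R; have rU := rmZ (u a)%:~R.
  have [inF|outF] := boolP (a \in F).
    have x1v : x1 a = v a by rewrite /x1 inF.
    rewrite -(ler_pM2l r0 _ (x0 a)) -(ler_pM2l r0 (x0 a)).
    move: inF x1v; rewrite inE /v /corner => aF; rewrite inE aF.
    case: ifP aF => g0 aF /= x1v; rewrite x1v in xEa *; rewrite lu lexx /=
      ?andbT; apply/andP; split; lra.
  have x0v : x0 a = v a by rewrite /x0 (negbTE outF).
  rewrite -(ler_pM2l m0 _ (x1 a)) -(ler_pM2l m0 (x1 a)).
  move: outF x0v; rewrite inE /v /corner => aF; rewrite inE (negbTE aF).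
  case: ifPn aF => g0; rewrite -ltNge => aF /= x0v; rewrite x0v in xEa *;
    rewrite lu lexx /=; apply/andP; split; lra.
have dx0 : dot g x0 = (corner_val l u g F)%:~R - fall l u g F x / r.
  rewrite /dot /corner_val rmorph_sum /fall mulr_suml /= [X in _ - X]big_mkcond /=.
  rewrite -sumrB; apply: eq_bigr => a _; rewrite /x0 /v rmorphM /=.
  by case: ifP => _; ring.
have dx1 : dot g x1 = (corner_val l u g F)%:~R + rise l u g F x / m.
  rewrite /dot /corner_val rmorph_sum /rise mulr_suml /= [X in _ + X]big_mkcond /=.
  rewrite -big_split; apply: eq_bigr => a _; rewrite /x1 /v rmorphM /=.
  by case: ifP => _ /=; ring.
have dsum : r * dot g x0 + m * dot g x1 = (k + m) * tau.
  by rewrite -sE -dot_comb; congr dot; apply/funext => a; rewrite -xE.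
have [x0lo|x0hi] := leP (dot g x0) (k * tau); last first.
  (* Here [D < r * (w - c * T)] and [U < m * ((c + 1) * T - w)], so the two quotients sum to less
     than [r + m = 1]. *)
  have x1lo : dot g x1 < (k + 1) * tau by nra.
  have D0 := fall_ge0 g F xb; have U0 := rise_ge0 g F xb.
  case: (noviol F).
  set w := corner_val l u g F in dx0 dx1 *.
  set D := fall l u g F x in dx0 D0 *; set U := rise l u g F x in dx1 U0 *.
  have Dr0 : 0 <= D / r by rewrite divr_ge0 // ltW.
  have Um0 : 0 <= U / m by rewrite divr_ge0 // ltW.
  have lo : c * T < w by rewrite -(ltr_int R) rmorphM /= -/k -/tau; lra.
  have hi : w < (c + 1) * T by rewrite -(ltr_int R) rmorphM rmorphD /= -/k -/tau; lra.
  split=> //; rewrite -[X in _ < X]rm ltrD //.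
    rewrite -/w -/D ltr_pdivrMr ?ltr0z ?subr_gt0 // mulrC -ltr_pdivrMr //.
    by rewrite rmorphB rmorphM /= -/tau -/k -/w -/D; lra.
  rewrite -/w -/U ltr_pdivrMr ?ltr0z ?subr_gt0 // mulrC -ltr_pdivrMr //.
  by rewrite rmorphB rmorphM rmorphD /= -/tau -/k -/w -/U; lra.
(* The segment from [x] to [x0] crosses the level [k * tau] at ratio [q]; moving [x1] by the same
   ratio preserves the combination. *)
pose q := (dot g x - k * tau) / (dot g x - dot g x0).
have den0 : 0 < dot g x - dot g x0 by lra.
have qE : q * (dot g x - dot g x0) = dot g x - k * tau.
  by rewrite /q mulfVK // gt_eqF.
have q01 : 0 <= q <= 1.
  apply/andP; split; last by rewrite /q ler_pdivrMr // mul1r; lra.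
  by rewrite /q divr_ge0 // ltW // subr_gt0.
exists r, (fun a => q * x0 a + (1 - q) * x a), (fun a => q * x1 a + (1 - q) * x a).
have m1 : 1 - r = m by rewrite /r; ring.
split.
- by rewrite ltW //=; lra.
- by split; exact: in_box_comb.
- apply/funext => a; rewrite m1.
  by transitivity (q * x a + (1 - q) * x a); [|rewrite {1}xE /r]; ring.
- by rewrite dot_comb; lra.
- rewrite dot_comb; suff : m * (q * dot g x1 + (1 - q) * dot g x) = m * ((k + 1) * tau).
    by move/(mulfI (lt0r_neq0 m0)).
  have -> : m * (q * dot g x1 + (1 - q) * dot g x) =
    q * (m * dot g x1) + m * (1 - q) * dot g x by ring.
  have -> : m * dot g x1 = (k + m) * tau - r * dot g x0 by rewrite -dsum; ring.
  rewrite sE in qE *; rewrite /r in qE *.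
  have -> : q * ((k + m) * tau - (1 - m) * dot g x0) =
    (1 - m) * (q * ((k + m) * tau - dot g x0)) + q * m * ((k + m) * tau) by ring.
  by rewrite qE; ring.
Qed.

End Flips.

(** * Compatibility of two flip inequalities on the free arc *)

(** The right-hand side is at least [X + Y] divided by the larger of [p] and [q]. *)
Lemma le_divD (R : realFieldType) (d X Y p q : R) : 0 <= X -> 0 <= Y ->
  0 < p -> 0 < q -> d * p <= X + Y -> d * q <= X + Y -> d <= X / p + Y / q.
Proof.
move=> X0 Y0 p0 q0 dp dq.
wlog pq : p q X Y X0 Y0 p0 q0 dp dq / p <= q.
  move=> H; have [|/ltW] := leP p q; first exact: H.
  by rewrite addrC => /H; apply=> //; rewrite addrC.
apply: (@le_trans _ _ (X / q + Y / q)); first by rewrite -mulrDl ler_pdivlMr.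
by rewrite lerD2r ler_wpM2l // lef_pV2.
Qed.

(* The combination of the flip inequality [fall / a + rise / (T - a) >= 1] at
   the lower bound of the free arc for [(g1, k1)] with the one at its upper bound
   for [(g2, k2)], at a point with [k2 * g1 - k1 * g2] in [m * T]. Here [k2 * D1 +
   k1 * U2] is at least both [d * a] and [d * (T - b)] for the integer
   [d = k2 * (c1 + 1) - k1 * c2 - m], if [d] is positive. *)
Lemma flip_pair (R : realType) (T l0 u0 k1 k2 n1 n2 c1 c2 m : int)
    (D1 U1 D2 U2 p q : R) (a b : R) :
  u0 - l0 = T - 1 -> 0 < k1 -> 0 < k2 ->
  0 <= D1 -> 0 <= U1 -> 0 <= D2 -> 0 <= U2 ->
  U1 - D1 = p - n1%:~R -> U2 - D2 = q - n2%:~R ->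
  k2%:~R * p - k1%:~R * q = (m * T)%:~R ->
  c1 * T < n1 + k1 * l0 < (c1 + 1) * T -> c2 * T < n2 + k2 * u0 < (c2 + 1) * T ->
  a = (n1 + k1 * l0 - c1 * T)%:~R -> b = (n2 + k2 * u0 - c2 * T)%:~R ->
  k2%:~R * ((T%:~R - a) * (1 - D1 / a) - U1)
    + k1%:~R * (b * (1 - U2 / (T%:~R - b)) - D2) <= k1%:~R * k2%:~R * (T - 1)%:~R.
Proof.
move=> u0E k1_gt0 k2_gt0 D10 U10 D20 U20 UD1 UD2 pq /andP[lo1 hi1] /andP[lo2 hi2] aE bE.
have k1_ge1 : 1 <= k1%:~R :> R by rewrite ler1z -gtz0_ge1.
have k2_ge1 : 1 <= k2%:~R :> R by rewrite ler1z -gtz0_ge1.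
have a1 : 1 <= a by rewrite aE ler1z -gtz0_ge1; lia.
have b1 : 1 <= b by rewrite bE ler1z -gtz0_ge1; lia.
have aT : a <= T%:~R - 1 by rewrite aE -(rmorphB _ T 1) ler_int; lia.
have bT : b <= T%:~R - 1 by rewrite bE -(rmorphB _ T 1) ler_int; lia.
pose d : int := k2 * (c1 + 1) - k1 * c2 - m.
have dE : d%:~R = k2%:~R * (c1%:~R + 1) - k1%:~R * c2%:~R - m%:~R :> R.
  by rewrite /d !rmorphB !rmorphM rmorphD.
have u0R : u0%:~R = l0%:~R + T%:~R - 1 :> R.
  by rewrite -(rmorphD _ l0 T) -(rmorphB _ _ 1) /=; congr intr; lia.
move: aE bE pq; rewrite !(rmorphB, rmorphD, rmorphM) /= u0R => aE bE pq.
set t : R := T%:~R in u0R aT bT aE bE pq *.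
suff H : d%:~R <= (k2%:~R * D1) / a + (k1%:~R * U2) / (t - b).
  have a0 : a != 0 by rewrite gt_eqF //; lra.
  have b0 : t - b != 0 by rewrite gt_eqF //; lra.
  have t0 : 0 <= t by lra.
  have {H} := ler_wpM2l t0 H; rewrite dE.
  have -> : t * (k2%:~R * D1 / a + k1%:~R * U2 / (t - b)) =
     k2%:~R * (D1 + (t - a) * (D1 / a)) + k1%:~R * (U2 + b * (U2 / (t - b))).
    by field; apply/andP.
  move: (D1 / a) (U2 / (t - b)) => X Y H.
  have -> : U1 = p - n1%:~R + D1 by lra.
  have -> : D2 = n2%:~R - q + U2 by lra.
  have -> : n1%:~R = a - k1%:~R * l0%:~R + c1%:~R * t :> R by lra.
  have -> : n2%:~R = b - k2%:~R * (l0%:~R + t - 1) + c2%:~R * t :> R by lra.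
  nra.
have kD1 : 0 <= k2%:~R * D1 by rewrite mulr_ge0 //; lra.
have kU2 : 0 <= k1%:~R * U2 by rewrite mulr_ge0 //; lra.
have [d0|d0] := leP d 0.
  apply: (@le_trans _ _ 0); first by rewrite lerz0.
  by rewrite addr_ge0 // divr_ge0 //; lra.
have d1 : 1 <= d%:~R :> R by rewrite ler1z -gtz0_ge1.
(* This is [0 <= k2 * U1 + k1 * D2] with [U1] and [D2] eliminated; [p] and [q] cancel by [pq]. *)
have sum_ge : t * d%:~R - t * k2%:~R + k2%:~R * a + k1%:~R * k2%:~R * (t - 1)
    - k1%:~R * b <= k2%:~R * D1 + k1%:~R * U2.
  have : 0 <= k2%:~R * U1 by rewrite mulr_ge0 //; lra.
  have : 0 <= k1%:~R * D2 by rewrite mulr_ge0 //; lra.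
  have -> : U1 = p - n1%:~R + D1 by lra.
  have -> : D2 = n2%:~R - q + U2 by lra.
  have -> : n1%:~R = a - k1%:~R * l0%:~R + c1%:~R * t :> R by lra.
  have -> : n2%:~R = b - k2%:~R * (l0%:~R + t - 1) + c2%:~R * t :> R by lra.
  by rewrite dE; lra.
clear UD1 UD2 pq aE bE u0R dE lo1 hi1 lo2 hi2 u0E k1_gt0 k2_gt0 d0 D10 U10 D20 U20.
move: (d%:~R : R) (k1%:~R : R) (k2%:~R : R) d1 k1_ge1 k2_ge1 sum_ge kD1 kU2.
move=> {}d {}k1 {}k2 d1 k11 k21 sum_ge kD1 kU2.
(* The slack over [d * a] is [(d - 1) * (t - a) + k1 * (t - 1 - b) + (k2 - 1) * ((k1 - 1) * (t - 1)
   + (a - 1))], and over [d * (t - b)] it is [(d - 1) * b + k2 * (a - 1) + (k1 - 1) * (t - 1 - b) +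
   (k1 - 1) * (k2 - 1) * (t - 1)]. *)
apply: le_divD => //; [lra|lra|apply: le_trans sum_ge|apply: le_trans sum_ge].
  have := mulr_ge0 (_ : 0 <= d - 1) (_ : 0 <= t - a).
  have := mulr_ge0 (_ : 0 <= k1) (_ : 0 <= t - 1 - b).
  have := mulr_ge0 (_ : 0 <= k2 - 1) (_ : 0 <= (k1 - 1) * (t - 1) + (a - 1)).
  have := mulr_ge0 (_ : 0 <= k1 - 1) (_ : 0 <= t - 1).
  by move=> /(_ ltac:(lra) ltac:(lra)) h1 /(_ ltac:(lra) ltac:(lra)) h2
    /(_ ltac:(lra) ltac:(lra)) h3 /(_ ltac:(lra) ltac:(lra)) h4; lra.
have := mulr_ge0 (_ : 0 <= d - 1) (_ : 0 <= b).
have := mulr_ge0 (_ : 0 <= k1 - 1) (_ : 0 <= t - 1 - b).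
have := mulr_ge0 (_ : 0 <= k2) (_ : 0 <= a - 1).
have := mulr_ge0 (_ : 0 <= (k1 - 1) * (k2 - 1)) (_ : 0 <= t - 1).
have := mulr_ge0 (_ : 0 <= k1 - 1) (_ : 0 <= k2 - 1).
by move=> /(_ ltac:(lra) ltac:(lra)) h1 /(_ ltac:(lra) ltac:(lra)) h2
  /(_ ltac:(lra) ltac:(lra)) h3 /(_ ltac:(lra) ltac:(lra)) h4
  /(_ ltac:(lra) ltac:(lra)) h5; lra.
Qed.

(** * A common value for the free arc *)

Definition affine (R : realType) (A : Type) (f : (A -> R) -> R) :=
  forall (r : R) x y,
    f (fun a => r * x a + (1 - r) * y a) = r * f x + (1 - r) * f y.

Section FreeValue.
Variables (R : realType) (A : finType) (l u : A -> int).
Implicit Types (g : A -> int) (x y : A -> R) (F : {set A}).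

Lemma rise_affine g F : affine (@rise R A l u g F).
Proof.
by move=> r x y; rewrite /rise !mulr_sumr -big_split /=; apply: eq_bigr => a _; ring.
Qed.

Lemma fall_affine g F : affine (@fall R A l u g F).
Proof.
by move=> r x y; rewrite /fall !mulr_sumr -big_split /=; apply: eq_bigr => a _; ring.
Qed.

Lemma dot_lincomb g1 g2 (k1 k2 : int) x :
  dot (fun a => k2 * g1 a - k1 * g2 a) x = k2%:~R * dot g1 x - k1%:~R * dot g2 x.
Proof.
rewrite /dot !mulr_sumr -sumrB; apply: eq_bigr => a _.
by rewrite rmorphB !rmorphM /=; ring.
Qed.

(* The two conclusions are the flip inequalities of [(g j, k j)] at the vertices
   with free arc at [l0] and at [u0], respectively. *)
Lemma free_value (J : Type) (g : J -> A -> int) (k : J -> int) (T l0 u0 : int) x :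
  1 < T -> u0 - l0 = T - 1 -> in_box l u x ->
  (forall i j (f : (A -> R) -> R), affine f ->
    (forall y (m : int), in_box l u y ->
      dot (fun a => k j * g i a - k i * g j a) y = (m * T)%:~R -> 0 <= f y) ->
    0 <= f x) ->
  exists2 t : R, l0%:~R <= t <= u0%:~R &
    forall j F (c : int), 0 < k j ->
      (forall n, n = corner_val l u (g j) F + k j * l0 ->
        c * T < n < (c + 1) * T ->
        1 <= fall l u (g j) F x / (n - c * T)%:~R +
          (rise l u (g j) F x + (k j)%:~R * (t - l0%:~R)) / ((c + 1) * T - n)%:~R) /\
      (forall n, n = corner_val l u (g j) F + k j * u0 ->
        c * T < n < (c + 1) * T ->
        1 <= (fall l u (g j) F x + (k j)%:~R * (u0%:~R - t)) / (n - c * T)%:~R +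
          rise l u (g j) F x / ((c + 1) * T - n)%:~R).
Proof.
move=> T1 u0E xb conv_x.
pose n j F (e : int) : int := corner_val l u (g j) F + k j * e.
pose D j F y := fall l u (g j) F y.
pose U j F y := rise l u (g j) F y.
(* Solved for [t], the two flip inequalities read [t >= l0 + lo / k] and [t <= u0 - hi / k]. *)
pose lo j F (c : int) y : R := let a := (n j F l0 - c * T)%:~R in
  (T%:~R - a) * (1 - D j F y / a) - U j F y.
pose hi j F (c : int) y : R := let b := (n j F u0 - c * T)%:~R in
  b * (1 - U j F y / (T%:~R - b)) - D j F y.
(* The lower bounds on [t], among them [l0]; their supremum will be the value. *)
pose E : set R := [set e | e = l0%:~R \/ exists j F c, [/\ 0 < k j,
  c * T < n j F l0 < (c + 1) * T & e = l0%:~R + lo j F c x / (k j)%:~R]].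
have u0R : u0%:~R = l0%:~R + T%:~R - 1 :> R.
  by rewrite -(rmorphD _ l0 T) -(rmorphB _ _ 1) /=; congr intr; lia.
have T1R : 1 <= T%:~R - 1 :> R by rewrite -(rmorphB _ T 1) ler1z; lia.
have frac (m c : int) : c * T < m < (c + 1) * T ->
    (1 <= ((m - c * T)%:~R : R) <= T%:~R - 1).
  by move=> /andP[h1 h2]; rewrite -(rmorphB _ T 1) ler_int ler1z; lia.
have frac' (m c : int) : ((c + 1) * T - m)%:~R = T%:~R - (m - c * T)%:~R :> R.
  by rewrite -rmorphB /=; congr intr; lia.
have kT j (z : R) : 0 < k j -> z <= T%:~R - 1 -> z / (k j)%:~R <= T%:~R - 1.
  move=> kj zT; have k1 : 1 <= (k j)%:~R :> R by rewrite ler1z -gtz0_ge1.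
  rewrite ler_pdivrMr; last lra.
  by apply: le_trans zT _; rewrite ler_peMr //; lra.
(* By integrality the vertex value is at distance at least 1 from the multiples of [T], so no single
   bound leaves [[l0, u0]]. *)
have loT j F c : c * T < n j F l0 < (c + 1) * T -> lo j F c x <= T%:~R - 1.
  move=> h; have /andP[a1 aT] := frac _ _ h; rewrite /lo.
  have U0 : 0 <= U j F x by exact: rise_ge0.
  have : 0 <= (T%:~R - (n j F l0 - c * T)%:~R) * (D j F x / (n j F l0 - c * T)%:~R).
    by rewrite mulr_ge0 ?divr_ge0 ?fall_ge0 //; lra.
  by rewrite mulrBr; lra.
have hiT j F c : c * T < n j F u0 < (c + 1) * T -> hi j F c x <= T%:~R - 1.
  move=> h; have /andP[b1 bT] := frac _ _ h; rewrite /hi.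
  have D0 : 0 <= D j F x by exact: fall_ge0.
  have : 0 <= (n j F u0 - c * T)%:~R * (U j F x / (T%:~R - (n j F u0 - c * T)%:~R)).
    by rewrite mulr_ge0 ?divr_ge0 ?rise_ge0 //; lra.
  by rewrite mulrBr; lra.
have lohi i F1 c1 j F2 c2 : 0 < k i -> 0 < k j ->
    c1 * T < n i F1 l0 < (c1 + 1) * T -> c2 * T < n j F2 u0 < (c2 + 1) * T ->
    lo i F1 c1 x / (k i)%:~R + hi j F2 c2 x / (k j)%:~R <= T%:~R - 1.
  move=> ki kj n1 n2.
  have ki0 : 0 < (k i)%:~R :> R by rewrite ltr0z.
  have kj0 : 0 < (k j)%:~R :> R by rewrite ltr0z.
  rewrite -(ler_pM2l (mulr_gt0 ki0 kj0)).
  have -> : (k i)%:~R * (k j)%:~R * (lo i F1 c1 x / (k i)%:~R + hi j F2 c2 x / (k j)%:~R)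
    = (k j)%:~R * lo i F1 c1 x + (k i)%:~R * hi j F2 c2 x.
    by field; rewrite !gt_eqF.
  rewrite -subr_ge0.
  (* The slack is affine in the point, so it need only be checked where the cycle combination
     cancelling the free arc is in [T Z]. *)
  apply: (conv_x i j (fun y => (k i)%:~R * (k j)%:~R * (T%:~R - 1)
    - ((k j)%:~R * lo i F1 c1 y + (k i)%:~R * hi j F2 c2 y))).
    move=> r y z; rewrite /lo /hi /D /U !(rise_affine, fall_affine) /=.
    move: (_ - (n i F1 l0 - c1 * T)%:~R) (_ - (n j F2 u0 - c2 * T)%:~R) => p q.
    by move: (_^-1) (_^-1) => ? ?; ring.
  move=> y m yb; rewrite dot_lincomb subr_ge0 => hy.
  rewrite -(rmorphB _ T 1).
  apply: (flip_pair u0E ki kj _ _ _ _ _ _ hy n1 n2 erefl erefl);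
    by [exact: fall_ge0|exact: rise_ge0|exact: rise_fall].
have supE : has_sup E.
  split; first by exists l0%:~R; left.
  exists u0%:~R => e [->|[j [F [c [kj nj ->]]]]]; first by rewrite u0R; lra.
  by rewrite u0R; have := kT _ _ kj (loT _ _ _ nj); lra.
have supl e : E e -> e <= sup E by move=> Ee; exact: ub_le_sup supE.2 _ Ee.
have supu w : (forall e, E e -> e <= w) -> sup E <= w.
  by move=> Ew; apply: ge_sup => //; exact: supE.1.
exists (sup E).
  apply/andP; split; first by apply: supl; left.
  apply: supu => e [->|[j [F [c [kj nj ->]]]]]; first by rewrite u0R; lra.
  by rewrite u0R; have := kT _ _ kj (loT _ _ _ nj); lra.
move=> j F c kj; have kj0 : 0 < (k j)%:~R :> R by rewrite ltr0z.
split=> _ -> nj; rewrite frac'.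
  have nj' : c * T < n j F l0 < (c + 1) * T := nj; have /andP[a1 aT] := frac _ _ nj'.
  have : l0%:~R + lo j F c x / (k j)%:~R <= sup E.
    by apply: supl; right; exists j, F, c.
  rewrite -lerBrDl ler_pdivrMr // /lo -/(n j F l0) => H.
  move: (n j F l0 - c * T) a1 aT H => a a1 aT H.
  have b0 : 0 < T%:~R - a%:~R :> R by lra.
  rewrite -(ler_pM2l b0) mulr1 mulrDr [_ * (_ / (_ - _))]mulrC divfK ?gt_eqF //.
  by move: H; rewrite mulrBr mulr1 -/(D j F x) -/(U j F x); lra.
have nj' : c * T < n j F u0 < (c + 1) * T := nj; have /andP[b1 bT] := frac _ _ nj'.
have : sup E <= u0%:~R - hi j F c x / (k j)%:~R.
  apply: supu => e [->|[i [F' [c' [ki ni ->]]]]].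
    by rewrite u0R; have := kT _ _ kj (hiT _ _ _ nj'); lra.
  by rewrite u0R; have := lohi _ _ _ _ _ _ ki kj ni nj'; lra.
rewrite lerBrDr -lerBrDl ler_pdivrMr // /hi -/(n j F u0) => H.
move: (n j F u0 - c * T) b1 bT H => b b1 bT H.
have b0 : 0 < b%:~R :> R by lra.
rewrite -(ler_pM2l b0) mulr1 mulrDr [X in _ <= X + _]mulrC divfK ?gt_eqF //.
by move: H; rewrite mulrBr mulr1 -/(D j F x) -/(U j F x); lra.
Qed.

End FreeValue.

(** * Split closures *)

Section ConvHull.
Variables (R : realType) (E : lmodType R).
Implicit Types (S X : set E) (p q : E).

Lemma convex_setP X : convex_set X <->
  forall (r : R) p q, 0 <= r <= 1 -> X p -> X q -> X (r *: p + (1 - r) *: q).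
Proof.
split=> [cX r p q /andP[r0 r1] Xp Xq|cX p q r].
  by have := cX p q (Itv01 r0 r1); rewrite !inE; apply.
by rewrite !inE => Xp Xq; apply: cX => //; rewrite ge0 le1.
Qed.

Lemma conv_hull_convex S : convex_set (conv_hull S).
Proof.
apply/convex_setP => r p q r01 Sp Sq X [cX SX].
by move/convex_setP: (cX); apply=> //; [exact: Sp|exact: Sq].
Qed.

Lemma conv_hull_comb S (r : R) p q : 0 <= r <= 1 ->
  conv_hull S p -> conv_hull S q -> conv_hull S (r *: p + (1 - r) *: q).
Proof. by move/convex_setP: (@conv_hull_convex S); apply. Qed.

Lemma sub_conv_hull S : S `<=` conv_hull S.
Proof. exact: sub_gen_smallest. Qed.

End ConvHull.

(** The preimage of a convex set under an affine map is convex. *)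
Lemma conv_hull_image (R : realType) (E E' : lmodType R) (h : E -> E')
    (S : set E) (S' : set E') :
  (forall (r : R) p q, h (r *: p + (1 - r) *: q) = r *: h p + (1 - r) *: h q) ->
  (forall p, S p -> S' (h p)) -> forall p, conv_hull S p -> conv_hull S' (h p).
Proof.
move=> hA SS'; apply: (@smallest_sub _ _ _ (h @^-1` conv_hull S')).
  by apply/convex_setP => r p q r01 /= Sp Sq; rewrite hA; exact: conv_hull_comb.
by move=> p /SS' /sub_conv_hull.
Qed.

(** * Split slices in terms of the arc variables *)

Section Instance.
Variables (R : realType) (I : pesp R) (B : cycle_basis I).
Implicit Types (p : xz_space B) (x y : arcs I -> R) (beta : {ffun B -> int}).

Local Notation T := ((period I)%:Z).
Local Notation box := (in_box (@lower R I) (@upper R I)).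

Definition gamma beta (a : arcs I) : int := \sum_b beta b * cb_cycle b a.

(* The variables [z] of a point of the polytope are determined by [x]. *)
Definition of_arcs x : xz_space B :=
  ([ffun a => x a], [ffun b => dot (cb_cycle b) x / (period I)%:R]).

Lemma period_gt0 : 0 < (period I)%:R :> R.
Proof. by rewrite ltr0n; have := period_ge2 I; lia. Qed.

Lemma polytope_box p : polytope B p -> box p.1.
Proof. by case. Qed.

Lemma polytopeE p : polytope B p -> of_arcs p.1 = p.
Proof.
move=> [pz _]; rewrite [p in RHS]surjective_pairing; congr (_, _); apply/ffunP => i.
  by rewrite ffunE.
by rewrite ffunE /dot pz mulrC mulKf // gt_eqF // period_gt0.
Qed.

Lemma dot_of_arcs g x : dot g (of_arcs x).1 = dot g x.
Proof. by apply: eq_bigr => a _; rewrite ffunE. Qed.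

Lemma polytope_of_arcs x : box x -> polytope B (of_arcs x).
Proof.
move=> xb; split=> [b|a]; last by rewrite ffunE; exact: xb.
rewrite ffunE mulrC divfK ?gt_eqF ?period_gt0 //.
exact: dot_of_arcs.
Qed.

Lemma of_arcs_comb (r : R) x y :
  of_arcs (fun a => r * x a + (1 - r) * y a) =
  r *: of_arcs x + (1 - r) *: of_arcs y.
Proof.
congr (_, _); apply/ffunP => i; rewrite !ffunE //.
by rewrite dot_comb mulrDl -!mulrA.
Qed.

Lemma dot_gamma beta p : polytope B p ->
  dot (gamma beta) p.1 = (period I)%:R * \sum_b (beta b)%:~R * p.2 b.
Proof.
move=> [pz _]; rewrite mulr_sumr; under [RHS]eq_bigr => b _ do
  rewrite mulrCA -pz mulr_sumr.
rewrite exchange_big /=; apply: eq_bigr => a _.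
rewrite /gamma rmorph_sum mulr_suml; apply: eq_bigr => b _.
by rewrite rmorphM mulrA.
Qed.

Lemma split_sliceP beta p : polytope B p ->
  split_slice B beta p <-> exists m : int, dot (gamma beta) p.1 = (m * T)%:~R.
Proof.
move=> pP; rewrite dot_gamma //; split=> [[_ /intrP[m ->]]|[m]].
  by exists m; rewrite rmorphM mulrC.
rewrite rmorphM mulrC => /(mulIf (lt0r_neq0 period_gt0)) mE.
by split=> //; rewrite mE intr_int.
Qed.

(** Reduces negative coefficients on the new arc to positive ones. *)
Lemma split_slice_opp beta : split_slice B (- beta) = split_slice B beta.
Proof.
apply/seteqP; split=> p [pP]; under eq_bigr => b _ do
  rewrite ?ffunE ?rmorphN ?mulNr; rewrite ?sumrN ?rpredN => pI; split=> //.
by under eq_bigr => b _ do rewrite ffunE rmorphN mulNr; rewrite sumrN rpredN.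
Qed.

(** Either [x] already gives a point of the slice, or [box_split] between consecutive multiples of
    the period writes it as a combination of two such points. *)
Lemma split_slice_hull beta x : box x ->
  (forall F c, ~ flip_violated T (@lower R I) (@upper R I) (gamma beta) F c x) ->
  conv_hull (split_slice B beta) (of_arcs x).
Proof.
move=> xb noviol.
have slice y m : box y -> dot (gamma beta) y = (m * T)%:~R ->
    conv_hull (split_slice B beta) (of_arcs y).
  move=> yb ym; apply: sub_conv_hull; apply/split_sliceP.
    exact: polytope_of_arcs.
  by exists m; rewrite dot_of_arcs.
have T0 : 0 < T by have := period_ge2 I; lia.
have T0R : 0 < T%:~R :> R by rewrite ltr0z.
set c := Num.floor (dot (gamma beta) x / T%:~R).
have [xc|xc] := eqVneq (dot (gamma beta) x) (c * T)%:~R; first exact: slice xc.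
have [|r [x0 [x1 [r01 [x0b x1b] -> x0c x1c]]]] :=
    @box_split _ _ T _ _ (gamma beta) x c T0 xb _ (noviol^~ c).
  rewrite lt_neqAle eq_sym xc !rmorphM /= -ler_pdivlMr // -ltr_pdivrMr //.
  by rewrite floor_le floorD1_gt.
by rewrite of_arcs_comb; apply: conv_hull_comb; [|apply: slice x0c|apply: slice x1c].
Qed.

(** The slice of the zero multiplier is the whole polytope, which is convex. *)
Lemma split_closure_polytope p : split_closure B p -> polytope B p.
Proof.
move=> /(_ 0 Logic.I); apply: smallest_sub; last by move=> q [].
apply/convex_setP => r q q' r01 qP q'P.
rewrite -(polytopeE qP) -(polytopeE q'P) -of_arcs_comb.
by apply/polytope_of_arcs/in_box_comb => //; exact: polytope_box.
Qed.

End Instance.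

(** * Simple free augmentations *)

Section Step.
Variables (R : realType) (I I' : pesp R) (s : simple_free_augmentation I I').

Local Notation new := (sfa_new s).
Local Notation old := (sfa_arc s).

Lemma big_arcs (V : nmodType) (G : arcs I' -> V) :
  \sum_a G a = G new + \sum_a G (old a).
Proof.
rewrite (bigD1 new) //=; congr (_ + _).
transitivity (\sum_(a <- codom old) G a); last by rewrite big_image.
rewrite [RHS]big_uniq /=; last by rewrite map_inj_uniq ?enum_uniq //; exact: sfa_arc_inj.
by apply: eq_bigl => a; rewrite -(sfa_arc_image s).
Qed.

(** Only [new] lies outside the image of [old], so the default [t] is the value of the new arc. *)
Definition extend (x : arcs I -> R) (t : R) (a' : arcs I') : R :=
  if [pick a | old a == a'] is Some a then x a else t.

Lemma extend_old x t a : extend x t (old a) = x a.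
Proof.
rewrite /extend; case: pickP => [b /eqP /(@sfa_arc_inj _ _ _ s) -> //|/(_ a)].
by rewrite eqxx.
Qed.

Lemma extend_new x t : extend x t new = t.
Proof.
rewrite /extend; case: pickP => // b /eqP eb.
have := sfa_arc_image s new; rewrite eqxx /= => /negbT/negP[].
by rewrite -eb; exact: codom_f.
Qed.

Lemma arcs_ind (P : arcs I' -> Prop) : P new -> (forall a, P (old a)) -> forall a, P a.
Proof.
move=> Pn Po a; have [->//|] := eqVneq a new.
by rewrite -(sfa_arc_image s) => /codomP[b ->].
Qed.

Lemma in_box_extend x t : in_box (@lower R I) (@upper R I) x ->
  (lower new)%:~R <= t <= (upper new)%:~R ->
  in_box (@lower R I') (@upper R I') (extend x t).
Proof.
move=> xb tb; apply: arcs_ind => [|a]; first by rewrite extend_new.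
by rewrite extend_old sfa_lower sfa_upper; exact: xb.
Qed.

Lemma dot_extend g x t :
  dot g (extend x t) = (g new)%:~R * t + dot (fun a => g (old a)) x.
Proof.
rewrite /dot big_arcs extend_new; congr (_ + _).
by apply: eq_bigr => a _; rewrite extend_old.
Qed.

Lemma corner_old g (F : {set arcs I'}) a :
  corner (@lower R I') (@upper R I') g F (old a) =
  corner (@lower R I) (@upper R I) (fun a => g (old a)) [set a | old a \in F]%SET a.
Proof. by rewrite /corner sfa_lower sfa_upper inE. Qed.

Lemma corner_val_extend g (F : {set arcs I'}) :
  corner_val (@lower R I') (@upper R I') g F =
  g new * corner (@lower R I') (@upper R I') g F new +
  corner_val (@lower R I) (@upper R I) (fun a => g (old a)) [set a | old a \in F]%SET.
Proof.
rewrite /corner_val big_arcs; congr (_ + _).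
by apply: eq_bigr => a _; rewrite corner_old.
Qed.

Lemma fall_extend g (F : {set arcs I'}) x t :
  fall (@lower R I') (@upper R I') g F (extend x t) =
  (if new \in F then (g new)%:~R * ((corner (@lower R I') (@upper R I') g F new)%:~R - t)
   else 0) +
  fall (@lower R I) (@upper R I) (fun a => g (old a)) [set a | old a \in F]%SET x.
Proof.
rewrite /fall big_mkcond big_arcs extend_new /=; congr (_ + _).
by rewrite [RHS]big_mkcond; apply: eq_bigr => a _; rewrite extend_old corner_old inE.
Qed.

Lemma rise_extend g (F : {set arcs I'}) x t :
  rise (@lower R I') (@upper R I') g F (extend x t) =
  (if new \in F then 0
   else (g new)%:~R * (t - (corner (@lower R I') (@upper R I') g F new)%:~R)) +
  rise (@lower R I) (@upper R I) (fun a => g (old a)) [set a | old a \in F]%SET x.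
Proof.
rewrite /rise big_mkcond big_arcs extend_new /= if_neg; congr (_ + _).
by rewrite [RHS]big_mkcond; apply: eq_bigr => a _; rewrite extend_old corner_old inE.
Qed.

(** * Projecting and lifting split closures along one augmentation *)

Variables (B : cycle_basis I) (B' : cycle_basis I') (e : basis_extension s B B').

Local Notation index := (be_index e).

Lemma cycle_dot_extend b x t :
  dot (cb_cycle (index b)) (extend x t) = dot (cb_cycle b) x.
Proof.
rewrite dot_extend be_new mul0r add0r.
by apply: eq_bigr => a _; rewrite be_old.
Qed.

Lemma dot_simple_projection p (b : B) :
  dot (cb_cycle b) (simple_projection e p).1 = dot (cb_cycle (index b)) p.1.
Proof.
rewrite [in RHS]/dot big_arcs be_new mul0r add0r.
by apply: eq_bigr => a _; rewrite be_old ffunE.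
Qed.

Lemma polytope_simple_projection p : polytope B' p -> polytope B (simple_projection e p).
Proof.
move=> [pz pb]; split=> [b|a]; last by rewrite ffunE -(sfa_lower s) -(sfa_upper s).
have := pz (index b); rewrite ffunE -(sfa_period s) => <-.
exact: dot_simple_projection.
Qed.

Lemma simple_projection_extend p t : polytope B p ->
  simple_projection e (of_arcs B' (extend p.1 t)) = p.
Proof.
move=> pP; rewrite -[RHS]polytopeE //; congr (_, _); apply/ffunP => i.
  by rewrite !ffunE extend_old.
by rewrite !ffunE cycle_dot_extend (sfa_period s).
Qed.

(** The multiplier is padded by zero, as an empty sum, on a cycle outside the image of [index]. *)
Lemma push_multiplier (beta : {ffun B -> int}) : exists beta' : {ffun B' -> int},
  forall z : B' -> R, \sum_b (beta' b)%:~R * z b = \sum_b (beta b)%:~R * z (index b).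
Proof.
exists [ffun b' => \sum_(b | index b == b') beta b] => z.
rewrite [RHS](partition_big index predT) //=; apply: eq_bigr => b' _.
by rewrite ffunE rmorph_sum mulr_suml; apply: eq_bigr => b /eqP ->.
Qed.

(* If the new arc is not a bridge, it is used by exactly one cycle of [B']. *)
Lemma pull_multiplier (beta' : {ffun B' -> int}) : gamma beta' new = 0 ->
  exists beta : {ffun B -> int},
    forall z : B' -> R, \sum_b (beta' b)%:~R * z b = \sum_b (beta b)%:~R * z (index b).
Proof.
move=> new0; exists [ffun b => beta' (index b)] => z.
under [RHS]eq_bigr => b _ do rewrite ffunE.
transitivity (\sum_(b <- codom index) (beta' b)%:~R * z b); last by rewrite big_image.
rewrite [RHS]big_uniq /=; last by rewrite map_inj_uniq ?enum_uniq //; exact: be_inj.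
rewrite [RHS]big_mkcond; apply: eq_bigr => b _; case: ifPn => // bP.
suff -> : beta' b = 0 by rewrite mul0r.
have [/(be_bridge e) br|/(be_not_bridge e)[g [g0 gP]]] := pselect (bridge new).
  by move: bP; rewrite (br b).
have /eqP bg : b == g by apply: contraNT bP; rewrite -gP.
move: new0; rewrite /gamma (bigD1 g) //= big1 => [|c].
  by rewrite addr0 bg => /eqP; rewrite mulf_eq0 (negbTE g0) orbF => /eqP.
by rewrite -gP => /codomP[d ->]; rewrite be_new mulr0.
Qed.

(** By [betaE] the split only sees the old cycles, on which [t] has no influence. *)
Lemma split_slice_extend (beta' : {ffun B' -> int}) (beta : {ffun B -> int}) p (t : R) :
  (forall z : B' -> R, \sum_b (beta' b)%:~R * z b = \sum_b (beta b)%:~R * z (index b)) ->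
  (lower new)%:~R <= t <= (upper new)%:~R ->
  split_slice B beta p -> split_slice B' beta' (of_arcs B' (extend p.1 t)).
Proof.
move=> betaE tb [pP pI]; split.
  by apply/polytope_of_arcs/in_box_extend => //; exact: polytope_box.
rewrite betaE; move: pI; rewrite -{1}(simple_projection_extend t pP).
by under eq_bigr => b _ do rewrite ffunE.
Qed.

Lemma split_closure_projection p :
  split_closure B' p -> split_closure B (simple_projection e p).
Proof.
move=> pS beta _; have [beta' betaE] := push_multiplier beta.
apply: (conv_hull_image _ _ (pS beta' Logic.I)) => [r q q'|q [qP qI]].
  by congr (_, _); apply/ffunP => i; rewrite !ffunE.
split; first exact: polytope_simple_projection.
by under eq_bigr => b _ do rewrite ffunE; rewrite -betaE.
Qed.

Lemma split_closure_lift p : split_closure B p ->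
  exists2 p', split_closure B' p' & simple_projection e p' = p.
Proof.
move=> pS; have pP := split_closure_polytope pS; have pb := polytope_box pP.
have T1 : 1 < (period I')%:Z by have := period_ge2 I'; lia.
have newE := sfa_free s.
have newb : (lower new)%:~R <= ((lower new)%:~R : R) <= (upper new)%:~R.
  by rewrite lexx ler_int; lia.
pose g (beta' : {ffun B' -> int}) a := gamma beta' (old a).
pose k (beta' : {ffun B' -> int}) := gamma beta' new.
(* The index type consists of all multipliers, so a single [t] serves every split. *)
have [|t tb tP] := @free_value R _ _ _ _ g k _ _ _ p.1 T1 newE pb.
  move=> i j f f_affine f_ge0.
  (* The coefficients on the new arc cancel in [h], which therefore comes from a multiplier of
     [B]. *)
  pose h : {ffun B' -> int} := [ffun b => k j * i b - k i * j b].
  have gammah a : gamma h a = k j * gamma i a - k i * gamma j a.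
    rewrite /gamma !mulr_sumr -sumrB; apply: eq_bigr => b _.
    by rewrite ffunE; ring.
  have h0 : gamma h new = 0 by rewrite gammah -/(k i) -/(k j) mulrC subrr.
  have [beta betaE] := pull_multiplier h0.
  (* The half-space [0 <= f] is convex, so it suffices that it contains the slice. *)
  move: (pS beta Logic.I); apply: (@smallest_sub _ _ _ [set q : xz_space B | 0 <= f q.1]).
    apply/convex_setP => r q q' /andP[r0 r1] /= fq fq'.
    have -> : (r *: q + (1 - r) *: q').1 = (fun a => r * q.1 a + (1 - r) * q'.1 a) :> (_ -> R).
      by apply/funext => a; rewrite !ffunE.
    by rewrite f_affine addr_ge0 // mulr_ge0 // subr_ge0.
  move=> q qS /=; have q'S := split_slice_extend betaE newb qS.
  have [q'P _] := q'S; move/(split_sliceP _ q'P): q'S => [m].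
  rewrite dot_of_arcs dot_extend h0 mul0r add0r => qm.
  apply: (f_ge0 _ m); first exact: polytope_box qS.1.
  by rewrite -qm; apply: eq_bigr => a _; rewrite gammah.
exists (of_arcs B' (extend p.1 t)); last exact: simple_projection_extend.
have pos beta' : 0 < k beta' ->
    conv_hull (split_slice B' beta') (of_arcs B' (extend p.1 t)).
  move=> kpos; apply: split_slice_hull; first exact: in_box_extend.
  move=> F c []; rewrite fall_extend rise_extend corner_val_extend /corner.
  rewrite -/(k beta') kpos addrC.
  (* As [k] is positive, the vertex has the new arc at its upper bound if [new] is in [F] and at its
     lower bound otherwise, matching the two conclusions of [free_value]. *)
  case: (boolP (new \in F)) => [_|/negbTE _] /=; rewrite add0r => lo hi; rewrite ltNge => /negP[].
    have [_] := tP _ [set a | old a \in F]%SET c kpos.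
    move=> /(_ _ erefl); rewrite lo hi => /(_ isT).
    by rewrite [X in _ <= X / _ + _ -> _]addrC.
  have [] := tP _ [set a | old a \in F]%SET c kpos.
  move=> /(_ _ erefl); rewrite lo hi => /(_ isT) + _.
  by rewrite [X in _ <= _ + X / _ -> _]addrC.
move=> beta' _; have [k0|kneg|] := ltgtP 0 (k beta').
- exact: pos.
- rewrite -split_slice_opp; apply: pos.
  rewrite /k /gamma; under eq_bigr => b _ do rewrite ffunE mulNr.
  by rewrite sumrN oppr_gt0.
- move/esym => k0; have [beta betaE] := pull_multiplier k0.
  (* With [t] fixed, extension is affine and carries the slice of [beta] into that of [beta']. *)
  pose lift (q : xz_space B) : xz_space B' := of_arcs B' (extend q.1 t).
  apply: (@conv_hull_image _ _ _ lift _ _ _ _ _ (pS beta Logic.I)).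
    move=> r q q'; rewrite /lift -of_arcs_comb; congr of_arcs; apply/funext.
    apply: arcs_ind => [|a]; first by rewrite !extend_new; ring.
    by rewrite !extend_old !ffunE.
  by move=> q; exact: split_slice_extend.
Qed.

Lemma simple_projection_split_closure :
  simple_projection e @` split_closure B' = split_closure B.
Proof.
apply/seteqP; split=> [_ [p pS <-]|p /split_closure_lift[p' p'S <-]].
  exact: split_closure_projection.
by exists p'.
Qed.

End Step.

(** * Sequences of augmentations *)

Theorem theorem5p11 (R : realType) (I I' : pesp R)
    (B : cycle_basis I) (B' : cycle_basis I') (f : free_augmentation B B') :
  natural_projection f @` split_closure B' = split_closure B.
Proof.
elim: f => [|I1 I2 B1 B2 s e f IH] /=; first by rewrite image_id.
by rewrite -image_comp simple_projection_split_closure IH.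
Qed.
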